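(* Let $L$ be a finite-dimensional Lie algebra over a field $F$. Then $L$ is supersolvable if and only if every maximal subalgebra $M$ of $L$ has an element $C\in S(M)$ with $\dim C/k(C)=1$.
   Context: $L$ is supersolvable if there is a chain $0=L_0\subset\cdots\subset L_n=L$ of ideals of $L$ with one-dimensional successive quotients. For a nonzero subalgebra $X$ of $L$, the strict core $k(X)$ is the sum of all ideals of $L$ that are proper subalgebras of $X$ (it is $0$ if there are none). For a maximal subalgebra $M$, a subalgebra $C$ is a completion of $M$ if $C\not\subseteq M$ but every proper subalgebra of $C$ that is an ideal of $L$ is contained in $M$; $I(M)$ is the set of completions. A subalgebra $C$ is a subideal of $L$ if there is a chain $C=C_0\subseteq C_1\subseteq\cdots\subseteq C_n=L$ with each $C_i$ an ideal of $C_{i+1}$. $S(M)=\{C\in I(M): C \text{ is a subideal of } L \text{ and } L=M+C\}$. *)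

(* Defs.v *)
From HB Require Import structures.
From mathcomp Require Import all_boot all_order all_algebra.
From Stdlib Require Import ClassicalEpsilon.
Set Implicit Arguments. Unset Strict Implicit. Unset Printing Implicit Defensive.
Import GRing.Theory.
Local Open Scope ring_scope.

Section Lie.
Variables (F : fieldType) (L : vectType F) (br : L -> L -> L).

Definition lie_bracket : Prop :=
  [/\ (forall a x y z, br (a *: x + y) z = a *: br x z + br y z),
      (forall a x y z, br x (a *: y + z) = a *: br x y + br x z),
      (forall x, br x x = 0) &
      (forall x y z, br x (br y z) + br y (br z x) + br z (br x y) = 0)].

Definition subalgebra (U : {vspace L}) : Prop :=
  forall u v, u \in U -> v \in U -> br u v \in U.

Definition ideal_of (I K : {vspace L}) : Prop :=
  (I <= K)%VS /\ forall x u, x \in K -> u \in I -> br x u \in I.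

Definition ideal (I : {vspace L}) : Prop := ideal_of I fullv.

Definition proper_sub (U V : {vspace L}) : Prop := (U <= V)%VS /\ U <> V.

Definition maximal_subalgebra (M : {vspace L}) : Prop :=
  [/\ subalgebra M, M <> fullv &
      forall K, subalgebra K -> (M <= K)%VS -> K = M \/ K = fullv].

Definition supersolvable : Prop :=
  exists (n : nat) (s : nat -> {vspace L}),
    [/\ s 0%N = 0%VS, s n = fullv,
        (forall i, (i <= n)%N -> ideal (s i)) &
        (forall i, (i < n)%N ->
           (s i <= s i.+1)%VS /\ \dim (s i.+1) = (\dim (s i)).+1)].

(* K is the sum of all ideals of L that are proper subalgebras of X,
   i.e. the least subspace containing all of them *)
Definition is_strict_core (X K : {vspace L}) : Prop :=
  (forall I, ideal I -> subalgebra I -> proper_sub I X -> (I <= K)%VS) /\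
  (forall V : {vspace L},
     (forall I, ideal I -> subalgebra I -> proper_sub I X -> (I <= V)%VS) ->
     (K <= V)%VS).

(* the strict core k(X) (the sum exists since L is finite-dimensional) *)
Definition strict_core (X : {vspace L}) : {vspace L} :=
  epsilon (inhabits 0%VS) (is_strict_core X).

Definition completion (M C : {vspace L}) : Prop :=
  [/\ subalgebra C, ~ (C <= M)%VS &
      forall I, subalgebra I -> proper_sub I C -> ideal I -> (I <= M)%VS].

Definition subideal (C : {vspace L}) : Prop :=
  exists (n : nat) (s : nat -> {vspace L}),
    [/\ s 0%N = C, s n = fullv &
        forall i, (i < n)%N -> ideal_of (s i) (s i.+1)].

Definition in_S (M C : {vspace L}) : Prop :=
  [/\ completion M C, subideal C & (M + C)%VS = fullv].

End Lie.

(* Main.v *)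
Require Import Defs.
From mathcomp Require Import all_boot all_order all_algebra.
From mathcomp Require Import ring zify.
From Stdlib Require Import Classical ClassicalEpsilon.
Set Implicit Arguments. Unset Strict Implicit. Unset Printing Implicit Defensive.
Import GRing.Theory.
Local Open Scope ring_scope.

(** If [L] is supersolvable, take for [C] a minimal ideal not contained in [M]:
    intersecting [C] with a chain of ideals shows [dim C / k(C) = 1].

    Conversely [L = M + C] and [k(C) <= M] force [M] to be a hyperplane.  Going up
    the subideal chain of [C], the factor [C / k(C)] is replaced at each stage [T]
    by a one-dimensional factor [J / Q] of ideals of [T] with [Q <= M] and not
    [J <= M]: if [Q'] is the largest ideal of [T] inside [M], then [Q'] is an
    ideal of the next stage, [T / Q'] has dimension at most 2, and one takes
    [J = T] or [J = [T, T] + Q'].  At the top [J] and [Q] are ideals of [L].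

    By induction on the codimension of an ideal [B], [L / B] is supersolvable.
    Let [A / B] be a minimal ideal of [L / B]; then [L / A] is supersolvable.
    If some maximal subalgebra containing [B] does not contain [A], its factor
    [J / Q] shows [dim A / B = 1].  Otherwise [A / B] is a Frattini ideal, hence
    abelian by Fitting's decomposition and Engel's theorem.  Let [K / A] be a
    one-dimensional ideal of [L / A].  If [K] acted nontrivially on [A / B], a
    Fitting null component would supplement [A].  So [K] centralises [A / B], and
    if [dim A / B > 1], a cohomology vanishing argument splits [K / B] as
    [A / B + Z / B] with [Z] an ideal; one then replaces [(B, A)] by [(Z, K)]. *)

(** Turns a vector identity into scalar ones, which [ring] can settle in [vect_ring]. *)
Lemma coord_vbasis_inj (F : fieldType) (L : vectType F) (u v : L) :
  (forall i, coord (vbasis {:L}) i u = coord (vbasis {:L}) i v) -> u = v.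
Proof.
move=> e; rewrite (coord_vbasis (memvf u)) (coord_vbasis (memvf v)).
by apply: eq_bigr => i _; rewrite e.
Qed.

Ltac vect_ring :=
  apply: coord_vbasis_inj => ?;
  rewrite ?(linearD, linearB, linearN, linearZ, linear0) /=; ring.

Ltac vmem :=
  repeat first [assumption | exact: mem0v | apply: memvB | apply: memvD
               | apply: memvZ | rewrite memvN | done].

(** * Subspaces of a finite-dimensional space *)

Section Subspaces.
Variables (F : fieldType) (L : vectType F).
Implicit Types (U V W K : {vspace L}) (P : L -> Prop) (Q : {vspace L} -> Prop).

Lemma dim_proper V W : (V <= W)%VS -> V <> W -> (\dim V < \dim W)%N.
Proof.
move=> sVW neVW; rewrite ltn_neqAle dimvS // andbT; apply/eqP => ed; apply: neVW.
by apply/eqP; rewrite eqEdim sVW ed leqnn.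
Qed.

Lemma maximal_vspace Q V0 : Q V0 ->
  exists V, [/\ Q V, (V0 <= V)%VS & forall W, Q W -> (V <= W)%VS -> W = V].
Proof.
have [n] := ubnP (\dim {:L} - \dim V0); elim: n V0 => // n IHn V0 le_n QV0.
have [[W [QW sV0W neW]]|nW] := classic
    (exists W, [/\ Q W, (V0 <= W)%VS & W <> V0]); last first.
  exists V0; split=> // W QW sVW.
  by apply: NNPP => neW; apply: nW; exists W.
have ltd : (\dim V0 < \dim W)%N by apply: dim_proper => // /esym.
have leW := dimvS (subvf W).
have [|V [QV sWV maxV]] := IHn W _ QW; first by lia.
by exists V; split=> //; apply: subv_trans sWV.
Qed.

Lemma minimal_vspace Q V0 : Q V0 ->
  exists V, [/\ Q V, (V <= V0)%VS & forall W, Q W -> (W <= V)%VS -> W = V].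
Proof.
have [n] := ubnP (\dim V0); elim: n V0 => // n IHn V0 le_n QV0.
have [[W [QW sWV0 neW]]|nW] := classic
    (exists W, [/\ Q W, (W <= V0)%VS & W <> V0]); last first.
  exists V0; split=> // W QW sVW.
  by apply: NNPP => neW; apply: nW; exists W.
have ltd := dim_proper sWV0 neW.
have [|V [QV sWV maxV]] := IHn W _ QW; first by lia.
by exists V; split=> //; apply: subv_trans sWV0.
Qed.

Lemma memv_addline V x y :
  reflect (exists a, y - a *: x \in V) (y \in (V + <[x]>)%VS).
Proof.
apply: (iffP memv_addP) => [[u Vu [_ /vlineP[a ->] ->]]|[a Va]].
  by exists a; rewrite addrK.
exists (y - a *: x) => //; exists (a *: x); last by rewrite subrK.
by rewrite memvZ ?memv_line.
Qed.

Lemma memv_addlineE V x : x \in (V + <[x]>)%VS.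
Proof. by apply/memv_addline; exists 1; rewrite scale1r subrr mem0v. Qed.

Lemma memvZ_eq V a x : a != 0 -> (a *: x \in V) = (x \in V).
Proof.
move=> nz_a; apply/idP/idP => [Vax|]; last exact: memvZ.
by rewrite -[x]scale1r -(mulVf nz_a) -scalerA memvZ.
Qed.

Lemma dim_addline V x : x \notin V -> \dim (V + <[x]>) = (\dim V).+1.
Proof.
move=> nVx; rewrite dimv_disjoint_sum.
  by rewrite dim_vline; case: eqP nVx => [->|_]; rewrite ?mem0v //= addn1.
apply/eqP; rewrite -subv0; apply/subvP => y; rewrite memv_cap => /andP[Vy].
case/vlineP => a ea; move: Vy; rewrite ea; have [->|nz_a] := eqVneq a 0.
  by rewrite scale0r !mem0v.
by rewrite memvZ_eq // (negPf nVx).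
Qed.

Lemma addline_sub V K x : (V <= K)%VS -> x \in K -> (V + <[x]> <= K)%VS.
Proof. by move=> sVK Kx; rewrite subv_add sVK -memvE. Qed.

Lemma addline_step V K x : (V <= K)%VS -> \dim K = (\dim V).+1 ->
  x \in K -> x \notin V -> K = (V + <[x]>)%VS.
Proof.
move=> sVK dK Kx nVx; apply/eqP; rewrite eq_sym eqEdim addline_sub //=.
by rewrite dim_addline // dK.
Qed.

Lemma not_subvP V W : ~ (V <= W)%VS -> exists2 v, v \in V & v \notin W.
Proof.
move=> nVW; apply: NNPP => nv; apply: nVW; apply/subvP => v Vv.
by apply/idPn => nWv; apply: nv; exists v.
Qed.

Lemma proper_subvP V W : (W <= V)%VS -> W <> V -> exists2 v, v \in V & v \notin W.
Proof.
move=> sWV neWV; apply: not_subvP => sVW; apply: neWV.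
by apply/eqP; rewrite eqEsubv sWV.
Qed.

Lemma step_exists V K : (V <= K)%VS -> \dim K = (\dim V).+1 ->
  exists2 x, x \notin V & K = (V + <[x]>)%VS.
Proof.
move=> sVK dK; have [|x Kx nVx] := proper_subvP sVK.
  by move=> e; move: dK; rewrite e; lia.
by exists x => //; apply: addline_step.
Qed.

Definition linear_pred P := P 0 /\ forall a x y, P x -> P y -> P (a *: x + y).

(** [P] may be undecidable, so the subspace is chosen by epsilon; it is meaningful when [P] is a
    [linear_pred]. *)
Definition vset P : {vspace L} :=
  epsilon (inhabits 0%VS) (fun V => forall x, x \in V <-> P x).

(** A maximal subspace inside [P] absorbs each [x] satisfying [P], since adding the line of [x]
    stays inside [P]. *)
Lemma mem_vset P : linear_pred P -> forall x, x \in vset P <-> P x.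
Proof.
case=> P0 Plin; apply: (epsilon_spec _ (fun V => forall x, x \in V <-> P x)).
have [|V [PV _ maxV]] := @maximal_vspace (fun V => forall x, x \in V -> P x) 0%VS.
  by move=> x; rewrite memv0 => /eqP->.
exists V => x; split=> [|Px]; first exact: PV.
suff <- : (V + <[x]>)%VS = V by apply: memv_addlineE.
apply: maxV (addvSl _ _) => y /memv_addline[a Va].
by rewrite -[y](subrK (a *: x)) addrC; apply: Plin Px (PV _ Va).
Qed.

Lemma increasing_chain_stable (K : nat -> {vspace L}) :
  (forall n, K n <= K n.+1)%VS -> exists N, forall n, (N <= n)%N -> K n = K N.
Proof.
move=> incK; have [|V [[N ->] _ maxV]] :=
  @maximal_vspace (fun V => exists n, V = K n) (K 0%N); first by exists 0%N.
exists N => n leNn; apply: maxV; first by exists n.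
rewrite -(subnK leNn); elim: (n - N)%N => // m IHm.
by rewrite addSn; apply: subv_trans (incK _).
Qed.

Lemma decreasing_chain_stable (K : nat -> {vspace L}) :
  (forall n, K n.+1 <= K n)%VS -> exists N, forall n, (N <= n)%N -> K n = K N.
Proof.
move=> decK; have [|V [[N ->] _ minV]] :=
  @minimal_vspace (fun V => exists n, V = K n) (K 0%N); first by exists 0%N.
exists N => n leNn; apply: minV; first by exists n.
rewrite -(subnK leNn); elim: (n - N)%N => // m IHm.
by rewrite addSn; apply: subv_trans (decK _) _.
Qed.

End Subspaces.

Section LieTheory.
Variables (F : fieldType) (L : vectType F) (br : L -> L -> L).
Hypothesis hL : lie_bracket br.
Implicit Types (A B C I J K M Q S T U V W Z : {vspace L}).

(** * Bracket identities and ideals *)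

Lemma brDl x y z : br (x + y) z = br x z + br y z.
Proof. by case: hL => h _ _ _; have := h 1 x y z; rewrite !scale1r. Qed.

Lemma brDr x y z : br x (y + z) = br x y + br x z.
Proof. by case: hL => _ h _ _; have := h 1 x y z; rewrite !scale1r. Qed.

Lemma br0l x : br 0 x = 0.
Proof. by apply: (addrI (br 0 x)); rewrite -brDl !addr0. Qed.

Lemma br0r x : br x 0 = 0.
Proof. by apply: (addrI (br x 0)); rewrite -brDr !addr0. Qed.

Lemma brZl a x y : br (a *: x) y = a *: br x y.
Proof. by case: hL => h _ _ _; have := h a x 0 y; rewrite addr0 br0l addr0. Qed.

Lemma brZr a x y : br x (a *: y) = a *: br x y.
Proof. by case: hL => _ h _ _; have := h a x y 0; rewrite addr0 br0r addr0. Qed.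

Lemma brNl x y : br (- x) y = - br x y.
Proof. by rewrite -scaleN1r brZl scaleN1r. Qed.

Lemma brNr x y : br x (- y) = - br x y.
Proof. by rewrite -scaleN1r brZr scaleN1r. Qed.

Definition brE := (brDl, brDr, brNl, brNr, brZl, brZr, br0l, br0r).

Lemma brxx x : br x x = 0.
Proof. by case: hL. Qed.

Lemma brC x y : br x y = - br y x.
Proof.
apply/eqP; rewrite -addr_eq0; apply/eqP.
by have := brxx (x + y); rewrite !brE !brxx add0r addr0.
Qed.

Lemma br_jacobi x y z : br x (br y z) = br (br x y) z + br y (br x z).
Proof.
have [_ _ _ /(_ x y z) h] := hL.
apply/eqP; rewrite -subr_eq0 -h; apply/eqP.
rewrite (brC (br x y)) (brC x z) brNr; vect_ring.
Qed.

Lemma idealP I : ideal br I <-> forall x u, u \in I -> br x u \in I.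
Proof.
split=> [[_ h] x u|h]; first by apply: h; rewrite memvf.
by split=> [|x u _]; [apply: subvf | apply: h].
Qed.

Lemma ideal_brr I x u : ideal br I -> u \in I -> br x u \in I.
Proof. by move/idealP; apply. Qed.

Lemma ideal_brl I x u : ideal br I -> u \in I -> br u x \in I.
Proof. by move=> iI Iu; rewrite brC memvN ideal_brr. Qed.

Lemma ideal_subalgebra I : ideal br I -> subalgebra br I.
Proof. by move=> iI u v _; apply: ideal_brr. Qed.

Lemma ideal_full : ideal br fullv.
Proof. by apply/idealP => x u _; rewrite memvf. Qed.

Lemma ideal0 : ideal br 0%VS.
Proof. by apply/idealP => x u; rewrite !memv0 => /eqP->; rewrite br0r. Qed.

Lemma ideal_cap I J : ideal br I -> ideal br J -> ideal br (I :&: J)%VS.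
Proof.
move=> iI iJ; apply/idealP => x u; rewrite !memv_cap => /andP[Iu Ju].
by rewrite !ideal_brr.
Qed.

Lemma ideal_add I J : ideal br I -> ideal br J -> ideal br (I + J)%VS.
Proof.
move=> iI iJ; apply/idealP => x u /memv_addP[i Ii [j Jj ->]].
by rewrite brDr memv_add ?ideal_brr.
Qed.

Lemma subalgebra_addideal U I :
  subalgebra br U -> ideal br I -> subalgebra br (U + I)%VS.
Proof.
move=> aU iI _ _ /memv_addP[u Uu [i Ii ->]] /memv_addP[v Uv [j Ij ->]].
rewrite !brDl !brDr -addrA memv_add ?aU //.
by vmem; first [exact: ideal_brr | exact: ideal_brl].
Qed.

Lemma ideal_addline I x : ideal br I ->
  (forall y, br y x \in (I + <[x]>)%VS) -> ideal br (I + <[x]>)%VS.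
Proof.
move=> iI h; apply/idealP => y u /memv_addline[a Iu].
rewrite -[u](subrK (a *: x)) brDr brZr memvD ?memvZ //.
by apply: (subvP (addvSl _ _)); apply: ideal_brr.
Qed.

(** * Nilpotency modulo an ideal *)

Lemma iter_br_linear n x a u v :
  iter n (br x) (a *: u + v) = a *: iter n (br x) u + iter n (br x) v.
Proof. by elim: n => //= n ->; rewrite brDr brZr. Qed.

Lemma iter_br_ideal n x u I : ideal br I -> u \in I -> iter n (br x) u \in I.
Proof. by move=> iI Iu; elim: n => //= n IHn; apply: ideal_brr. Qed.

(** As [br x] is a derivation, one more application falls on [u] or on [v]; double induction
    replaces the binomial expansion. *)
Lemma iter_br_leibniz x I m n u v : ideal br I ->
  iter m (br x) u \in I -> iter n (br x) v \in I ->
  iter (m + n) (br x) (br u v) \in I.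
Proof.
move=> iI; elim: m n u v => [|m IHm] n u v.
  by move=> Iu _; apply: iter_br_ideal => //; apply: ideal_brl.
elim: n u v => [|n IHn] u v Iu Iv.
  by apply: iter_br_ideal => //; apply: ideal_brr.
rewrite addSn iterSr br_jacobi.
rewrite -[br (br x u) v]scale1r iter_br_linear scale1r; apply: memvD.
  by apply: IHm; rewrite -?iterSr.
by rewrite -addSnnS; apply: IHn => //; rewrite -iterSr.
Qed.

(** [U] is the Fitting null component of [br x] modulo [B]; the complementary component consists,
    modulo [B], of values of [iter m (br x)], which lie in [A]. *)
Lemma fitting_supplement A B x m :
  ideal br B -> (forall u, iter m (br x) u \in A) ->
  exists U N, [/\ subalgebra br U, (B <= U)%VS, (U + A)%VS = fullv &
                  forall u, u \in U -> iter N (br x) u \in B].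
Proof.
move=> iB hA; pose f n := iter n (br x).
have f0 n : f n 0 = 0 by elim: n => //= n IH; rewrite /f /= -/(f n) IH br0r.
pose K n := vset (fun u => f n u \in B).
have memK n u : u \in K n <-> f n u \in B.
  apply: (mem_vset (P := fun u => f n u \in B)); split=> [|a {}u v Bu Bv].
    by rewrite f0 mem0v.
  by rewrite /f iter_br_linear memvD ?memvZ.
pose im n y := exists u b, b \in B /\ y = f n u + b.
have memR n y : y \in vset (im n) <-> im n y.
  apply: mem_vset; split=> [|a _ _ [u [b [Bb ->]]] [v [c [Bc ->]]]].
    by exists 0, 0; rewrite f0 mem0v addr0.
  exists (a *: u + v), (a *: b + c); split; first by rewrite memvD ?memvZ.
  by rewrite /f iter_br_linear; vect_ring.
have [N1 hN1] : exists N, forall n, (N <= n)%N -> K n = K N.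
  apply: increasing_chain_stable => n; apply/subvP => u /memK Bu.
  by apply/memK; apply: ideal_brr.
have [N2 hN2] : exists N, forall n, (N <= n)%N -> vset (im n) = vset (im N).
  apply: decreasing_chain_stable => n; apply/subvP => y /memR[u [b [Bb ->]]].
  by apply/memR; exists (br x u), b; rewrite /f iterSr.
(* From [N] on, kernels and images modulo [B] are stationary and iterates take values in [A]. *)
pose N := maxn m (maxn N1 N2).
have leN1 : (N1 <= N)%N by rewrite /N; lia.
have leN2 : (N2 <= N)%N by rewrite /N; lia.
have leNm : (m <= N)%N by rewrite /N; lia.
exists (K N), N; split; last by move=> u /memK.
- move=> u v /memK Bu /memK Bv; rewrite (hN1 N) // -(hN1 (N + N)%N); last by lia.
  by apply/memK; apply: iter_br_leibniz.
- by apply/subvP => b Bb; apply/memK; apply: iter_br_ideal.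
apply/eqP; rewrite eqEsubv subvf /=; apply/subvP => u _.
(* Modulo [B], [f N u] is some [f (N + N) w]; so [u - f N w] is in the null component, and [f N w]
   is in [A]. *)
have : f N u \in vset (im N) by apply/memR; exists u, 0; rewrite mem0v addr0.
rewrite (hN2 N) // -(hN2 (N + N)%N); last by lia.
case/memR => w [b [Bb e]]; rewrite -[u](subrK (f N w)); apply: memv_add.
  apply/memK; have -> : f N (u - f N w) = f N u - f N (f N w).
    by rewrite addrC -scaleN1r /f iter_br_linear scaleN1r addrC.
  by rewrite e /f iterD addrAC subrr add0r.
by rewrite /f -(subnKC leNm) iterD.
Qed.

(** Engel's theorem for [S] acting on [V / W]. The induction hypothesis is used twice for a maximal
    proper subalgebra [S'] over [B]: on [S / S'] it yields [b] normalising [S'], whence [S = S' +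
    <[b]>]; on [V / W] it yields a vector killed by [S']. *)
Lemma engel_mod B S V W : ideal br B -> subalgebra br S -> (B <= S)%VS ->
  (forall x, x \in S -> exists N, forall u, iter N (br x) u \in B) ->
  (B <= W)%VS -> (W <= V)%VS -> W <> V ->
  (forall x v, x \in S -> v \in V -> br x v \in V) ->
  (forall x v, x \in S -> v \in W -> br x v \in W) ->
  exists v, [/\ v \in V, v \notin W & forall x, x \in S -> br x v \in W].
Proof.
move=> iB; have [n] := ubnP (\dim S); elim: n S V W => // n IHn S V W leSn.
move=> aS sBS nilS sBW sWV neWV SV SW.
have [eBS|neBS] := eqVneq B S.
  have [v Vv nWv] := proper_subvP sWV neWV; exists v; split=> // x.
  by rewrite -eBS => Bx; apply: (subvP sBW); apply: ideal_brl.
have [|S' [[aS' sS'S neS'S] sBS' maxS']] := @maximal_vspace F L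
    (fun V => [/\ subalgebra br V, (V <= S)%VS & V <> S]) B.
  by split=> //; [apply: ideal_subalgebra | apply/eqP].
have ltS' : (\dim S' < n)%N by have := dim_proper sS'S neS'S; lia.
have nilS' x : x \in S' -> exists N, forall u, iter N (br x) u \in B.
  by move=> S'x; apply: nilS; apply: (subvP sS'S).
have [||b [Sb nS'b S'b]] := IHn S' S S' ltS' aS' sBS' nilS' sBS' sS'S neS'S.
- by move=> x v S'x Sv; apply: aS => //; apply: (subvP sS'S).
- by move=> x v; apply: aS'.
have eS : (S' + <[b]>)%VS = S.
  apply: NNPP => neS; case/negP: nS'b; rewrite -(maxS' (S' + <[b]>)%VS).
  - exact: memv_addlineE.
  - split=> //; last exact: addline_sub.
    move=> _ _ /memv_addP[u S'u [_ /vlineP[a ->] ->]]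
      /memv_addP[v S'v [_ /vlineP[c ->] ->]]; apply/memv_addline.
    exists 0; rewrite scale0r subr0 !brE brxx.
    have S'bl x : x \in S' -> br b x \in S' by move=> h; rewrite brC memvN S'b.
    by vmem; first [exact: aS' | exact: S'b | exact: S'bl].
  - exact: addvSl.
pose P v := v \in V /\ forall x, x \in S' -> br x v \in W.
have memP v : v \in vset P <-> P v.
  apply: mem_vset; split=> [|a u w [Vu Wu] [Vw Ww]].
    by split=> [|x _]; rewrite ?br0r mem0v.
  split=> [|x S'x]; first by vmem.
  by rewrite brDr brZr; vmem; auto.
have [||v0 [Vv0 nWv0 Wv0]] := IHn S' V W ltS' aS' sBS' nilS' sBW sWV neWV.
- by move=> x v S'x; apply: SV; apply: (subvP sS'S).
- by move=> x v S'x; apply: SW; apply: (subvP sS'S).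
have Pb v : P v -> P (br b v).
  case=> Vv Wv; split=> [|x S'x]; first exact: SV.
  rewrite br_jacobi memvD //; last by apply: SW; rewrite ?Wv.
  by apply: Wv; apply: S'b.
have exN : exists N, iter N (br b) v0 \in W.
  by have [N hN] := nilS b Sb; exists N; apply: (subvP sBW).
(* The last iterate of [v0] outside [W] is killed modulo [W] by [b], and still by [S'] because [b]
   normalises [S']. *)
case: (ex_minnP exN) => -[|N] /= WN minN; first by rewrite WN in nWv0.
have [VN WN'] : P (iter N (br b) v0) by elim: N {WN minN} => //= N; apply: Pb.
exists (iter N (br b) v0); split=> //.
  by apply/negP => /minN; rewrite ltnn.
move=> x; rewrite -eS => /memv_addP[s S's [_ /vlineP[a ->] ->]].
by rewrite brDl brZl; vmem; apply: WN'.
Qed.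

(** * Chief factors of supersolvable quotients *)

(* [ss_above B]: the quotient [L / B] is supersolvable. *)
Inductive ss_above : {vspace L} -> Prop :=
| ss_above_full : ss_above fullv
| ss_above_step B K : ideal br B -> ideal br K -> (B <= K)%VS ->
    \dim K = (\dim B).+1 -> ss_above K -> ss_above B.

Lemma supersolvable_ss_above : supersolvable br <-> ss_above 0%VS.
Proof.
split=> [[n [s [s0 sn si sS]]]|].
  suff h i : (i <= n)%N -> ss_above (s (n - i)%N).
    by rewrite -s0 -(subnn n); apply: h.
  elim: i => [|i IHi] lt_in; first by rewrite subn0 sn; constructor.
  have e : (n - i)%N = (n - i.+1).+1 by lia.
  have [|sub dm] := sS (n - i.+1)%N; first by lia.
  apply: (ss_above_step (K := s (n - i)%N)); rewrite ?e //.
  - by apply: si; lia.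
  - by apply: si; lia.
  - by rewrite -e; apply: IHi; lia.
rewrite /supersolvable; move: 0%VS => B0.
elim=> [|B K iB iK sBK dK _ [n [s [s0 sn si sS]]]].
  exists 0%N, (fun _ => fullv); split=> // i _; exact: ideal_full.
exists n.+1, (fun i => if i is j.+1 then s j else B).
split=> //; first by case=> // i; apply: si.
by case=> [|i]; [rewrite s0 | apply: sS].
Qed.

Definition chief_factor B A := [/\ ideal br B, ideal br A, (B <= A)%VS, B <> A &
  forall I, ideal br I -> (B <= I)%VS -> (I <= A)%VS -> I = B \/ I = A].

Lemma chief_factor_proper B A I : chief_factor B A -> ideal br I ->
  (B <= I)%VS -> (I <= A)%VS -> (exists2 a, a \in A & a \notin I) -> I = B.
Proof.
by case=> _ _ _ _ h iI sBI sIA [a Aa nIa]; case: (h I) => // e; rewrite e Aa in nIa.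
Qed.

Lemma chief_factor_nonzero B A I : chief_factor B A -> ideal br I ->
  (B <= I)%VS -> (I <= A)%VS -> (exists2 a, a \in I & a \notin B) -> I = A.
Proof.
by case=> _ _ _ _ h iI sBI sIA [a Ia nBa]; case: (h I) => // e; rewrite -e Ia in nBa.
Qed.

Lemma chief_factor_line B A a : chief_factor B A -> a \in A -> a \notin B ->
  (forall x, br x a \in (B + <[a]>)%VS) -> \dim A = (\dim B).+1.
Proof.
move=> chAB Aa nBa h; have [iB iA sBA _ _] := chAB.
rewrite -(@chief_factor_nonzero B A (B + <[a]>)%VS) ?dim_addline //.
- exact: ideal_addline.
- exact: addvSl.
- exact: addline_sub.
- by exists a => //; apply: memv_addlineE.
Qed.

(* Schur's lemma for an operator that normalises the action of [L]. *)
Lemma chief_factor_schur B A (g : L -> L) : chief_factor B A ->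
  (forall a u v, g (a *: u + v) = a *: g u + g v) ->
  (forall u, u \in A -> g u \in A) -> (forall u, u \in B -> g u \in B) ->
  (forall x, exists c, forall u, u \in A ->
     br x (g u) - g (br x u) - c *: g u \in B) ->
  (exists2 u, u \in A & g u \notin B) ->
  (forall y, y \in A -> exists2 u, u \in A & y - g u \in B) /\
  (forall u, u \in A -> g u \in B -> u \in B).
Proof.
move=> chAB glin gA gB gbr [u0 Au0 nBgu0]; have [iB iA sBA _ _] := chAB.
have g0 : g 0 = 0.
  by apply: (addrI (g 0)); have := glin 1 0 0; rewrite !scale1r !addr0 => <-.
split=> [y|u] Ay.
  (* The image of [g] modulo [B] is an ideal: [br x (g w)] agrees with [g (br x w + c *: w)] modulo
     [B]. *)
  pose R y := exists2 u, u \in A & y - g u \in B.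
  have memR z : z \in vset R <-> R z.
    apply: mem_vset; split=> [|a v w [v' Av' Bv] [w' Aw' Bw]].
      by exists 0; rewrite ?g0 ?subr0 mem0v.
    exists (a *: v' + w'); first by vmem.
    have -> : a *: v + w - g (a *: v' + w') = a *: (v - g v') + (w - g w').
      by rewrite glin; vect_ring.
    by vmem.
  have eR : vset R = A; last by move: Ay; rewrite -{1}eR => /memR.
  apply: (chief_factor_nonzero chAB).
  - apply/idealP => x v /memR[w Aw Bvw]; apply/memR.
    have [c hc] := gbr x; exists (br x w + c *: w).
      by vmem; apply: ideal_brr.
    have -> : br x v - g (br x w + c *: w) =
        br x (v - g w) + (br x (g w) - g (br x w) - c *: g w).
      by rewrite (addrC (br x w)) glin !brE; vect_ring.
    by apply: memvD; [apply: ideal_brr | apply: hc].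
  - apply/subvP => b Bb; apply/memR; exists 0; first exact: mem0v.
    by rewrite g0 subr0.
  - apply/subvP => v /memR[w Aw Bvw]; rewrite -[v](subrK (g w)).
    by apply: memvD; [apply: (subvP sBA) | apply: gA].
  - by exists (g u0) => //; apply/memR; exists u0; rewrite // subrr mem0v.
(* Dually, the kernel of [g] modulo [B] is an ideal, and [u0] shows that it is not all of [A]. *)
move=> Bgu; pose N v := v \in A /\ g v \in B.
have memN z : z \in vset N <-> N z.
  apply: mem_vset; split=> [|a v w [Av Bv] [Aw Bw]].
    by rewrite /N g0 !mem0v.
  by split; rewrite ?glin; vmem.
rewrite -(@chief_factor_proper B A (vset N)) //; first exact/memN.
- apply/idealP => x v /memN[Av Bv]; apply/memN; split; first exact: ideal_brr.
  have [c hc] := gbr x.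
  have -> : g (br x v) = br x (g v) - c *: g v -
      (br x (g v) - g (br x v) - c *: g v).
    by vect_ring.
  by apply: memvB; [vmem; apply: ideal_brr | apply: hc].
- by apply/subvP => b Bb; apply/memN; split; [apply: (subvP sBA) | apply: gB].
- by apply/subvP => v /memN[].
- by exists u0 => //; apply/negP => /memN[_ h]; rewrite h in nBgu0.
Qed.

(* Equivalently, every maximal subalgebra containing [B] contains [A]. *)
Definition frattini_over B A := forall U, subalgebra br U -> (B <= U)%VS ->
  (U + A)%VS = fullv -> U = fullv.

Lemma frattini_nilpotent B A x m : ideal br B -> frattini_over B A ->
  (forall u, iter m (br x) u \in A) -> exists N, forall u, iter N (br x) u \in B.
Proof.
move=> iB frBA /(fitting_supplement iB)[U [N [aU sBU eUA hU]]].
by exists N => u; apply: hU; rewrite (frBA U) ?memvf.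
Qed.

(** For [x] in [A], [br x] maps [L] into [A], so it is nilpotent modulo [B]. Engel gives a nonzero
    vector of [A / B] centralised by [A]; such vectors form an ideal, which is then all of
    [A / B]. *)
Lemma frattini_chief_abelian B A : chief_factor B A -> frattini_over B A ->
  forall x a, x \in A -> a \in A -> br x a \in B.
Proof.
move=> chAB frBA; have [iB iA sBA neBA _] := chAB.
have [|||v [Av nBv Bv]] :=
  @engel_mod B A A B iB (ideal_subalgebra iA) sBA _ (subvv B) sBA neBA.
- by move=> x Ax; apply: (@frattini_nilpotent B A x 1) => // u; apply: ideal_brl.
- by move=> x u _; apply: ideal_brr.
- by move=> x u _; apply: ideal_brr.
pose P v := v \in A /\ forall x, x \in A -> br x v \in B.
have memP z : z \in vset P <-> P z.
  apply: mem_vset; split=> [|a u w [Au Bu] [Aw Bw]].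
    by split=> [|x _]; rewrite ?br0r mem0v.
  by split=> [|x Ax]; rewrite ?brDr ?brZr; vmem; [apply: Bu | apply: Bw].
have eP : vset P = A; last by move=> x a Ax; rewrite -eP => /memP[_]; apply.
apply: (chief_factor_nonzero chAB).
- apply/idealP => x u /memP[Au Bu]; apply/memP; split; first exact: ideal_brr.
  move=> y Ay; rewrite br_jacobi memvD //; last by apply: ideal_brr => //; apply: Bu.
  by apply: Bu; apply: ideal_brl.
- apply/subvP => b Bb; apply/memP.
  by split=> [|x _]; [apply: (subvP sBA) | apply: ideal_brr].
- by apply/subvP => b /memP[].
- by exists v => //; apply/memP.
Qed.

(** Climb the chain above [S] to its first term outside [C]; [t] spans the factor entered there, so
    [L] acts on [t] by scalars modulo [C]. *)
Lemma ss_above_exit S C : ss_above S -> (S <= C)%VS -> C <> fullv ->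
  exists S' t, [/\ (S' <= C)%VS, t \notin C & ideal br (S' + <[t]>)%VS].
Proof.
move=> ssS sSC neC; elim: ssS sSC => [sfC|B K iB iK sBK dK _ IH sBC].
  by case: neC; apply/eqP; rewrite eqEsubv sfC subvf.
have [/IH//|/negP/not_subvP[t Kt nCt]] := boolP (K <= C)%VS.
exists B, t; split=> //; rewrite -(addline_step sBK) //.
by apply: contra nCt => /(subvP sBC).
Qed.

(* The twist [rho l u = br l u - chi l *: u], with [chi] the weight of [K / A],
   makes [K / A] a trivial module. *)
Lemma chief_split B A K : chief_factor B A -> ideal br K -> (A <= K)%VS ->
  \dim K = (\dim A).+1 -> (forall x a, x \in K -> a \in A -> br x a \in B) ->
  ss_above A -> \dim A <> (\dim B).+1 ->
  exists Z, [/\ ideal br Z, (B <= Z)%VS, (Z + A)%VS = K & (Z :&: A)%VS = B].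
Proof.
move=> chAB iK sAK dK hKA ssA ndA; have [iB iA sBA neBA _] := chAB.
have [k nAk eK] := step_exists sAK dK.
have Kk : k \in K by rewrite eK memv_addlineE.
have [chi chiP] : exists chi : L -> F, forall l, br l k - chi l *: k \in A.
  have h l : exists c : F, br l k - c *: k \in A.
    by have := ideal_brr l iK Kk; rewrite {1}eK => /memv_addline.
  exists (fun l => proj1_sig (constructive_indefinite_description _ (h l))) => l.
  by case: constructive_indefinite_description.
have chi_uniq l c : br l k - c *: k \in A -> chi l = c.
  move=> Ac; apply/eqP; rewrite -subr_eq0; apply/negPn/negP => nz.
  case/negP: nAk; rewrite -(memvZ_eq _ _ nz).
  have -> : (chi l - c) *: k = (br l k - c *: k) - (br l k - chi l *: k).
    by vect_ring.
  by have := chiP l; apply: memvB.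
have chi_lin a x y : chi (a *: x + y) = a * chi x + chi y.
  apply: chi_uniq; have Ax := chiP x; have Ay := chiP y.
  have -> : br (a *: x + y) k - (a * chi x + chi y) *: k =
      a *: (br x k - chi x *: k) + (br y k - chi y *: k).
    by rewrite !brE; vect_ring.
  by apply: memvD => //; apply: memvZ.
(* Scalars commute, so the character [chi] vanishes on brackets; hence [rho] is again a
   representation. *)
have chi_br x y : chi (br x y) = 0.
  apply: chi_uniq; rewrite scale0r subr0.
  have Ax := chiP x; have Ay := chiP y.
  have -> : br (br x y) k = br x (br y k) - br y (br x k).
    by rewrite (br_jacobi x); vect_ring.
  have -> : br x (br y k) - br y (br x k) =
    br x (br y k - chi y *: k) - br y (br x k - chi x *: k)
    + (chi y *: (br x k - chi x *: k) - chi x *: (br y k - chi y *: k)).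
    by rewrite !brE; vect_ring.
  apply: memvD; apply: memvB; first [exact: ideal_brr | exact: memvZ].
have chiK x : x \in K -> chi x = 0.
  rewrite {1}eK => /memv_addP[a Aa [_ /vlineP[c ->] ->]].
  apply: chi_uniq; rewrite !brE brxx scaler0 addr0 scale0r subr0.
  by rewrite brC memvN; apply: (subvP sBA); apply: hKA.
pose rho l u := br l u - chi l *: u.
have rhol a x y u : rho (a *: x + y) u = a *: rho x u + rho y u.
  by rewrite /rho chi_lin !brE; vect_ring.
have rhoB a x y u : rho (x - a *: y) u = rho x u - a *: rho y u.
  by rewrite addrC -scaleNr rhol scaleNr addrC.
have rhor l a u v : rho l (a *: u + v) = a *: rho l u + rho l v.
  by rewrite /rho !brE; vect_ring.
have rhoC x y u : rho x (rho y u) = rho (br x y) u + rho y (rho x u).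
  by rewrite /rho chi_br !brE (br_jacobi x); vect_ring.
have rhoI I l u : ideal br I -> u \in I -> rho l u \in I.
  by move=> iI Iu; apply: memvB; [apply: ideal_brr | apply: memvZ].
pose C := vset (fun l => forall a, a \in A -> rho l a \in B).
have memC l : l \in C <-> forall a, a \in A -> rho l a \in B.
  apply: (mem_vset (P := fun l => forall a, a \in A -> rho l a \in B)).
  have rho0 u : rho 0 u = 0.
    have := rhol (-1) 0 0 u; rewrite scaler0 addr0 => ->.
    by rewrite scaleN1r addNr.
  split=> [a _|a x y hx hy u Au]; first by rewrite rho0 mem0v.
  by rewrite rhol; apply: memvD; [apply: memvZ; apply: hx | apply: hy].
have iC : ideal br C.
  apply/idealP => x c /memC hc; apply/memC => a Aa.
  have -> : rho (br x c) a = rho x (rho c a) - rho c (rho x a).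
    by rewrite rhoC addrK.
  by apply: memvB; [apply: rhoI => //; apply: hc | apply: hc; apply: rhoI].
have sKC : (K <= C)%VS.
  apply/subvP => x Kx; apply/memC => a Aa.
  by rewrite /rho chiK // scale0r subr0; apply: hKA.
(* [C] is the kernel of the twisted action on [A / B]. Were it all of [L], any nonzero vector of
   [A / B] would span an ideal, forcing dimension one. *)
have neC : C <> fullv.
  move=> eC; have [a Aa nBa] := proper_subvP sBA neBA; apply: ndA.
  apply: (chief_factor_line chAB Aa nBa) => x; apply/memv_addline; exists (chi x).
  have Cx : x \in C by rewrite eC memvf.
  by move/memC: Cx; apply.
have [S [t [sSC nCt iSt]]] := ss_above_exit ssA (subv_trans sAK sKC) neC.
have brt x : exists c : F, br x t - c *: t \in C.
  have := ideal_brr x iSt (memv_addlineE S t).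
  by case/memv_addline => c /(subvP sSC) h; exists c.
(* [t] is an eigenvector of [L] modulo [C], so Schur's lemma makes [rho t] bijective on [A / B]. *)
have [|||||surj inj] := chief_factor_schur (g := rho t) chAB.
- exact: rhor.
- by move=> u; apply: rhoI.
- by move=> u; apply: rhoI.
- move=> x; have [c /memC hc] := brt x; exists c => u Au.
  have -> : br x (rho t u) - rho t (br x u) = rho (br x t) u.
    by rewrite /rho chi_br !brE (br_jacobi x); vect_ring.
  have -> : rho (br x t) u - c *: rho t u = rho (br x t - c *: t) u.
    by rewrite rhoB.
  exact: hc.
- apply: NNPP => h; case/negP: nCt; apply/memC => a Aa.
  by apply/idPn => nB; apply: h; exists a.
(* As [rho t k] lies in [A], surjectivity allows [k] to be corrected by some [a0] in [A] so that
   [rho t] sends it into [B]. *)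
have [a0 Aa0] := surj _ (chiP t); rewrite -/(rho t k) => Bk.
pose k0 := k - a0.
have rhok0 l : rho l k0 = rho l k - rho l a0.
  by rewrite /k0 addrC -scaleN1r rhor scaleN1r addrC.
have Btk0 : rho t k0 \in B by rewrite rhok0.
have Ak0 l : rho l k0 \in A.
  by rewrite rhok0; apply: memvB; [apply: chiP | apply: rhoI].
have Kk0 : k0 \in K by apply: memvB => //; apply: (subvP sAK).
have nAk0 : k0 \notin A.
  by apply: contra nAk => h; rewrite -(subrK a0 k) memvD.
(* [c |-> rho c k0] is an [L]-morphism (up to a twist) from [C] to [A / B]; its
   source has one-dimensional factors, so its image cannot be all of [A / B]. *)
have BCk0 : forall c, c \in C -> rho c k0 \in B.
  have : forall s, s \in A -> s \in C -> rho s k0 \in B.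
    move=> s As _; rewrite /rho chiK ?(subvP sAK) // scale0r subr0.
    by rewrite brC memvN; apply: hKA.
  (* Going up the chain from [A] to [L], a first [c] with [rho c k0] outside [B] is an eigenvector
     modulo the previous term; then [rho c k0] spans an ideal modulo [B], against [ndA]. *)
  elim: ssA => [h c Cc|B' K' iB' iK' sB'K' dK' _ IH hB'].
    by apply: h; rewrite ?memvf.
  apply: IH => c K'c Cc; apply/idPn => nBc.
  have nB'c : c \notin B' by apply/negP => B'c; rewrite hB' in nBc.
  apply: ndA; apply: (chief_factor_line chAB (Ak0 c) nBc) => s.
  have := ideal_brr s iK' K'c; rewrite {1}(addline_step sB'K' dK' K'c nB'c).
  case/memv_addline => mu B'd; apply/memv_addline; exists (mu + chi s).
  have -> : br s (rho c k0) - (mu + chi s) *: rho c k0 =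
      rho s (rho c k0) - mu *: rho c k0.
    by rewrite {3}/rho; vect_ring.
  rewrite rhoC.
  have -> : rho (br s c) k0 + rho c (rho s k0) - mu *: rho c k0 =
      rho (br s c - mu *: c) k0 + rho c (rho s k0).
    by rewrite rhoB; vect_ring.
  apply: memvD; last by move/memC: Cc; apply.
  by apply: hB' => //; vmem; apply: ideal_brr.
(* Since [br t s] is a multiple of [t] modulo [C], [rho t] sends [rho s k0] into [B], and
   injectivity concludes. *)
have Bk0 s : rho s k0 \in B.
  apply: inj => //; rewrite rhoC; apply: memvD; last exact: rhoI.
  have [c Cc] := brt s.
  have -> : br t s = (- c) *: t - 1 *: (br s t - c *: t).
    by rewrite (brC t); vect_ring.
  rewrite rhoB -[- c *: t]addr0 rhol.
  have -> : rho 0 k0 = 0 by rewrite /rho chiK ?mem0v // br0l scale0r subr0.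
  by rewrite addr0; apply: memvB; apply: memvZ => //; exact: BCk0.
have sBZ : (B <= B + <[k0]>)%VS := addvSl _ _.
exists (B + <[k0]>)%VS; split=> //.
- by apply: ideal_addline => // y; apply/memv_addline; exists (chi y); apply: Bk0.
- rewrite -addvA [(_ + A)%VS]addvC addvA (addv_idPr sBA).
  by rewrite (addline_step sAK dK Kk0).
apply/eqP; rewrite eqEsubv subv_cap sBZ sBA /= andbT; apply/subvP => y.
rewrite memv_cap => /andP[/memv_addP[b Bb [_ /vlineP[c ->] ->]] Ay].
have [->|nz_c] := eqVneq c 0; first by rewrite scale0r addr0.
case/negP: nAk0; rewrite -(memvZ_eq _ _ nz_c) -(addKr b (c *: k0)).
by apply: memvD => //; rewrite memvN; apply: (subvP sBA).
Qed.

(** Induction along [ss_above A] with [B] varying. That [A / B] is abelian is carried along, and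
    checked directly for the new pair [(Z, K)]. *)
Lemma frattini_chief_dim1 B A : ss_above A -> chief_factor B A ->
  frattini_over B A -> \dim A = (\dim B).+1.
Proof.
move=> ssA chAB frBA; have abAB := frattini_chief_abelian chAB frBA.
elim: ssA B chAB frBA abAB => [|{}A K iA iK sAK dK ssK IH] B chAB frBA abAB.
  have [iB _ sBA neBA _] := chAB; case: neBA; apply: frBA => //.
    exact: ideal_subalgebra.
  by apply/eqP; rewrite eqEsubv subvf addvSr.
have [iB _ sBA neBA minA] := chAB.
apply: NNPP => ndA.
have [hKA|nhKA] := classic (forall x a, x \in K -> a \in A -> br x a \in B).
  have ssA : ss_above A by apply: ss_above_step ssK.
  have [Z [iZ sBZ eZA eZcA]] := chief_split chAB iK sAK dK hKA ssA ndA.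
  have sZK : (Z <= K)%VS by rewrite -eZA addvSl.
  have dZ := dimv_sum_cap Z A; rewrite eZA eZcA in dZ.
  have leBA := dimvS sBA; apply: ndA; suff dKZ : \dim K = (\dim Z).+1 by lia.
  apply: IH.
  - split=> //; first by move=> eZK; apply: neBA; rewrite -eZcA eZK; apply/capv_idPr.
    (* The modular law recovers [I] from [A :&: I], so minimality passes from [A / B] to [K / Z]. *)
    move=> I iI sZI sIK.
    have eI : (Z + A :&: I)%VS = I by rewrite vspace_modl // eZA; apply/capv_idPr.
    have [|||e|e] := minA (A :&: I)%VS.
    + exact: ideal_cap.
    + by rewrite subv_cap sBA (subv_trans sBZ).
    + exact: capvSl.
    + by left; rewrite -eI e; apply/addv_idPl.
    + by right; rewrite -eI e.
  - move=> U aU sZU eUK; apply: frBA => //; first exact: subv_trans sZU.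
    by rewrite -eUK -eZA addvA (addv_idPl sZU).
  have [k nAk eK] := step_exists sAK dK.
  have Kk : k \in K by rewrite eK memv_addlineE.
  move=> x y Kx; rewrite {1}eK => /memv_addP[a Aa [_ /vlineP[c ->] ->]].
  move: Kx; rewrite {1}eK => /memv_addP[a' Aa' [_ /vlineP[c' ->] ->]].
  apply: (subvP sBZ); rewrite !brE brxx (brC a' k).
  by vmem; apply: hKA => //; apply: (subvP sAK).
have [k [a [Kk Aa nBka]]] : exists k a, [/\ k \in K, a \in A & br k a \notin B].
  apply: NNPP => h; apply: nhKA => x a Kx Aa; apply/idPn => nB; apply: h.
  by exists x, a.
have nAk : k \notin A by apply/negP => Ak; rewrite abAB in nBka.
have eK := addline_step sAK dK Kk nAk.
(* By Schur's lemma [br k] is injective on [A / B], yet the Frattini condition makes it nilpotent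
   modulo [B]. *)
have [|||||_ inj] := chief_factor_schur (g := br k) chAB.
- by move=> c u v; rewrite !brE.
- by move=> u; apply: ideal_brr.
- by move=> u; apply: ideal_brr.
- move=> x; have := ideal_brr x iK Kk; rewrite {1}eK => /memv_addline[c Ac].
  exists c => u Au; have -> : br x (br k u) - br k (br x u) - c *: br k u =
      br (br x k - c *: k) u by rewrite (br_jacobi x) !brE; vect_ring.
  exact: abAB.
- by exists a.
(* The exponent is 2: [br k] sends [L] into [K], and [K] into [A] because [br k k = 0]. *)
have [|N hN] := frattini_nilpotent (x := k) (m := 2) iB frBA.
  move=> u /=; have := ideal_brl u iK Kk; rewrite {1}eK.
  case/memv_addP => v Av [_ /vlineP[c ->] ->].
  by rewrite !brE brxx scaler0 addr0; apply: ideal_brr.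
have [v Av nBv] := proper_subvP sBA neBA; case/negP: nBv.
move: {hN}(hN v); elim: N v Av => // N IHN v Av; rewrite iterSr => /IHN h.
by apply: inj => //; apply: h; apply: ideal_brr.
Qed.

(** * Strict cores and completions *)

Lemma strict_coreP X : is_strict_core br X (strict_core br X).
Proof.
apply: (epsilon_spec _ (is_strict_core br X)).
pose Q V := forall I, ideal br I -> subalgebra br I ->
  Defs.proper_sub I X -> (I <= V)%VS.
have [|K [QK _ minK]] := @minimal_vspace F L Q fullv.
  by move=> I _ _ _; apply: subvf.
exists K; split=> // V QV; rewrite -(minK (K :&: V)%VS) ?capvSl ?capvSr //.
by move=> I iI aI pI; rewrite subv_cap QK ?QV.
Qed.

(** The vectors of the core that [L] maps into the core form a subspace containing every ideal
    summed, so by leastness it is the whole core. *)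
Lemma strict_core_ideal X : ideal br (strict_core br X).
Proof.
have [coreI coreV] := strict_coreP X; set K := strict_core br X in coreI coreV *.
pose P u := u \in K /\ forall x, br x u \in K.
have memP u : u \in vset P <-> P u.
  apply: mem_vset; split=> [|a v w [Kv hv] [Kw hw]].
    by split=> [|x]; rewrite ?br0r mem0v.
  by split=> [|x]; rewrite ?brE; vmem.
have /subvP sKP : (K <= vset P)%VS.
  apply: coreV => I iI aI pI; have /subvP sIK := coreI I iI aI pI.
  by apply/subvP => u Iu; apply/memP; split=> [|x]; apply: sIK; rewrite ?ideal_brr.
by apply/idealP => x u /sKP/memP[].
Qed.

Lemma strict_core_proper M C : completion br M C ->
  [/\ (strict_core br C <= M)%VS, (strict_core br C <= C)%VS &
      (\dim (strict_core br C) < \dim C)%N].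
Proof.
case=> aC nCM hC; have [_ coreV] := strict_coreP C.
have sKM : (strict_core br C <= M)%VS by apply: coreV => I iI aI pI; apply: hC.
have sKC : (strict_core br C <= C)%VS by apply: coreV => I iI aI [].
by split=> //; apply: dim_proper => // e; rewrite e in sKM.
Qed.

(** Take consecutive terms [B], [K] of the chain where [C] is inside [K] but not [B]: then [C :&: B]
    has codimension one in [C]. *)
Lemma ss_above_ideal_step S C : ss_above S -> ideal br C -> ~ (C <= S)%VS ->
  exists I, [/\ ideal br I, Defs.proper_sub I C & (\dim C <= (\dim I).+1)%N].
Proof.
move=> ssS iC; elim: ssS => [|B K iB iK sBK dK _ IH] nCB.
  by case: nCB; apply: subvf.
have [sCK|/negP/IH//] := boolP (C <= K)%VS.
exists (C :&: B)%VS; split; first exact: ideal_cap.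
  by split=> [|/capv_idPl//]; apply: capvSl.
have := dimv_sum_cap C B.
have : (\dim (C + B) <= \dim K)%N by apply: dimvS; rewrite subv_add sCK.
by rewrite dK; lia.
Qed.

Lemma supersolvable_completion M : ss_above 0%VS -> maximal_subalgebra br M ->
  exists C, in_S br M C /\ (\dim C - \dim (strict_core br C))%N = 1%N.
Proof.
move=> ss0 [aM neM maxM].
have [|C [[iC nCM] _ minC]] := @minimal_vspace F L
    (fun V => ideal br V /\ ~ (V <= M)%VS) fullv.
  split; first exact: ideal_full.
  by move=> sfM; apply: neM; apply/eqP; rewrite eqEsubv subvf.
have cC : completion br M C.
  split=> //; first exact: ideal_subalgebra.
  move=> I _ [sIC neIC] iI; apply/idPn => /negP nIM; apply: neIC.
  by apply: minC.
exists C; split.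
  split=> //.
    exists 1%N, (fun i => if i is 0%N then C else fullv); split=> //.
    by case.
  have [||e|//] := maxM (M + C)%VS.
  - exact: subalgebra_addideal.
  - exact: addvSl.
  - by case: nCM; rewrite -e addvSr.
have [_ _ ltd] := strict_core_proper cC.
have [|I [iI pI leI]] := ss_above_ideal_step ss0 iC.
  by move=> sC0; apply: nCM; apply: subv_trans sC0 (sub0v _).
have [/(_ I iI (ideal_subalgebra iI) pI)/dimvS leIK _] := strict_coreP C.
by lia.
Qed.

(** * Lifting a one-dimensional factor along the subideal chain *)

Lemma ideal_of_add T I J : ideal_of br I T -> ideal_of br J T ->
  ideal_of br (I + J)%VS T.
Proof.
move=> [sIT iI] [sJT iJ]; split; first by rewrite subv_add sIT.
move=> x _ Tx /memv_addP[i Ii [j Jj ->]].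
by rewrite brDr memv_add ?iI ?iJ.
Qed.

Lemma hyperplaneP M c : \dim {:L} = (\dim M).+1 -> c \notin M ->
  forall x, exists a, x - a *: c \in M.
Proof.
move=> dM nMc x; apply/memv_addline.
by rewrite -(addline_step (subvf M) dM (memvf c) nMc) memvf.
Qed.

Lemma hyperplane_cap M J Q : (Q <= J)%VS -> \dim J = (\dim Q).+1 ->
  (Q <= M)%VS -> ~ (J <= M)%VS -> (J :&: M)%VS = Q.
Proof.
move=> sQJ dJ sQM nJM; apply/eqP; rewrite eq_sym eqEdim subv_cap sQJ sQM /=.
have : (\dim (J :&: M) < \dim J)%N.
  by apply: dim_proper => [|/capv_idPl//]; apply: capvSl.
by lia.
Qed.

(* [M] separates the one-dimensional factor [J / Q] of ideals of [T]. *)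
Definition line_factor M T Q J := [/\ ideal_of br Q T, ideal_of br J T,
  (Q <= J)%VS /\ \dim J = (\dim Q).+1 & (Q <= M)%VS /\ ~ (J <= M)%VS].

(** Fix [c] in [J] outside the hyperplane [M]. Either [M :&: T] is an ideal of [T], and [J'] is [T];
    or some [br h c] with [h] in [M :&: T] leaves [M], and then [T] is spanned by [Q'], [h] and [c],
    and [J'] by [Q'] and [br h c]. *)
Lemma line_factor_lift M T T' Q J :
  subalgebra br M -> \dim {:L} = (\dim M).+1 -> ideal_of br T T' ->
  line_factor M T Q J -> exists Q' J', line_factor M T' Q' J'.
Proof.
move=> aM dM [sTT' iT] [iQ iJ [sQJ dJ] [sQM nJM]].
have aT : subalgebra br T by move=> u v Tu; apply: iT; apply: (subvP sTT').
have eJM := hyperplane_cap sQJ dJ sQM nJM.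
have [[sQT brQ] [sJT brJ]] := (iQ, iJ).
have [c Jc nMc] := not_subvP nJM.
have Tc := subvP sJT _ Jc.
have nQc : c \notin Q by apply: contra nMc => /(subvP sQM).
have decM := hyperplaneP dM nMc.
have [Q' [[iQ' sQ'M] sQQ' maxQ']] := @maximal_vspace F L
    (fun V => ideal_of br V T /\ (V <= M)%VS) Q (conj iQ sQM).
have coreQ' E : ideal_of br E T -> (E <= M)%VS -> (E <= Q')%VS.
  move=> iE sEM; rewrite -(maxQ' (Q' + E)%VS) ?addvSr ?addvSl //.
  by split; [apply: ideal_of_add | rewrite subv_add sQ'M].
have [sQ'T brQ'] := iQ'.
have brQ'M x : x \in M -> x \in T' -> forall q, q \in Q' -> br x q \in Q'.
  move=> Mx T'x q Q'q.
  (* [Q' + [x, Q']] is an ideal of [T] inside [M] by the Jacobi identity, so maximality makes it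
     equal to [Q']. *)
  pose P y := exists q1 q2, [/\ q1 \in Q', q2 \in Q' & y = q1 + br x q2].
  have memP y : y \in vset P <-> P y.
    apply: mem_vset; split=> [|a _ _ [u [v [Qu Qv ->]]] [u' [v' [Qu' Qv' ->]]]].
      by exists 0, 0; rewrite br0r addr0 mem0v.
    exists (a *: u + u'), (a *: v + v'); split; [by vmem | by vmem |].
    by rewrite !brE; vect_ring.
  have eP : vset P = Q'.
    apply: maxQ'; last first.
      by apply/subvP => u Qu; apply/memP; exists u, 0; rewrite br0r addr0 mem0v.
    split; last first.
      apply/subvP => _ /memP[u [v [Qu Qv ->]]].
      by apply: memvD; [apply: (subvP sQ'M) | apply: aM => //; apply: (subvP sQ'M)].
    split.
      apply/subvP => _ /memP[u [v [Qu Qv ->]]].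
      by apply: memvD; [apply: (subvP sQ'T) | apply: iT => //; apply: (subvP sQ'T)].
    move=> y _ Ty /memP[u [v [Qu Qv ->]]]; apply/memP.
    exists (br y u + br (br y x) v), (br y v); split; last 1 first.
    - by rewrite brDr (br_jacobi y); vect_ring.
    - apply: memvD; apply: brQ' => //.
      by rewrite brC memvN; apply: iT.
    exact: brQ'.
  by rewrite -eP; apply/memP; exists 0, q; rewrite mem0v add0r.
(* [T'] is spanned by [M :&: T'] and [c], and [c] lies in [T], of which [Q'] is an ideal. *)
have iQ'T' : ideal_of br Q' T'.
  split=> [|x q T'x Q'q]; first exact: subv_trans sTT'.
  have [a Ma] := decM x; rewrite -[x](subrK (a *: c)) brDl brZl.
  apply: memvD; last by apply: memvZ; apply: brQ'.
  apply: brQ'M => //; apply: memvB => //; apply: memvZ.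
  exact: (subvP sTT').
have decMT x : x \in T -> exists a, x - a *: c \in (M :&: T)%VS.
  move=> Tx; have [a Ma] := decM x; exists a; rewrite memv_cap Ma.
  by apply: memvB => //; apply: memvZ.
have [hM|nhM] := classic (forall m, m \in (M :&: T)%VS -> br m c \in M).
  have eQ' : (M :&: T)%VS = Q'.
    apply/eqP; rewrite eqEsubv subv_cap sQ'M sQ'T /= andbT.
    apply: coreQ'; last exact: capvSl.
    split; first exact: capvSr.
    move=> x m Tx MTm; have := MTm; rewrite memv_cap => /andP[Mm Tm].
    have [a] := decMT x Tx; rewrite !memv_cap => /andP[Ma Ta].
    rewrite (aT x m Tx Tm) andbT -[x](subrK (a *: c)) brDl brZl (brC c).
    by apply: memvD; [apply: aM | apply: memvZ; rewrite memvN; apply: hM].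
  exists Q', T; split=> //; split=> //.
    have <- : (Q' + <[c]>)%VS = T.
      apply/eqP; rewrite eqEsubv addline_sub //=; apply/subvP => x Tx.
      by apply/memv_addline; rewrite -eQ'; apply: decMT.
    by rewrite dim_addline //; apply: contra nMc => /(subvP sQ'M).
  by move/subvP/(_ c Tc) => Mc; rewrite Mc in nMc.
have [h [MTh nMhc]] : exists h, h \in (M :&: T)%VS /\ br h c \notin M.
  apply: NNPP => nh; apply: nhM => m MTm; apply/idPn => nMc'; apply: nh.
  by exists m.
have := MTh; rewrite memv_cap => /andP[Mh Th].
(* These [m] form an ideal of [T] inside [M], hence inside [Q']; the point is that [br m c] falls in
   [J :&: M = Q]. *)
pose P m := m \in (M :&: T)%VS /\ br m c \in M.
have memP m : m \in vset P <-> P m.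
  apply: mem_vset; split=> [|a u v [MTu Mu] [MTv Mv]].
    by split; rewrite ?br0l mem0v.
  by split; rewrite ?brE; vmem.
have sPQ' : (vset P <= Q')%VS.
  apply: coreQ'; last by apply/subvP => m /memP[]; rewrite memv_cap => /andP[].
  split; first by apply/subvP => m /memP[]; rewrite memv_cap => /andP[].
  move=> x m Tx /memP[]; rewrite memv_cap => /andP[Mm Tm] Mmc.
  have [a] := decMT x Tx; rewrite memv_cap => /andP[Ma Ta].
  have Qmc : br m c \in Q by rewrite -eJM memv_cap Mmc andbT; apply: brJ.
  apply/memP; split.
    rewrite memv_cap (aT x m Tx Tm) andbT -[x](subrK (a *: c)) brDl brZl (brC c).
    by apply: memvD; [apply: aM | apply: memvZ; rewrite memvN].
  have -> : br (br x m) c = br x (br m c) - br m (br x c).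
    by rewrite (br_jacobi x); vect_ring.
  have := brJ x c Tx Jc; rewrite {1}(addline_step sQJ dJ Jc nQc).
  move=> /memv_addP[q Qq [_ /vlineP[b ->] ->]]; rewrite brDr brZr.
  by apply: (subvP sQM); vmem; apply: brQ.
have decT x : x \in T -> exists q a b, q \in Q' /\ x = q + a *: h + b *: c.
  move=> Tx; have [b MTb] := decMT x Tx.
  (* Subtracting [a *: h] brings the bracket with [c] back into [M], so the remainder satisfies
     [P]. *)
  have [a Ma] := hyperplaneP dM nMhc (br (x - b *: c) c).
  exists (x - b *: c - a *: h), a, b; split; last by vect_ring.
  apply: (subvP sPQ'); apply/memP; split; first by apply: memvB => //; apply: memvZ.
  by rewrite brDl brNl brZl.
have brT x y : x \in T -> y \in T -> br x y \in (Q' + <[br h c]>)%VS.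
  move=> Tx Ty; have [p [a [b [Q'p ->]]]] := decT x Tx.
  have [q [a' [b' [Q'q ey]]]] := decT y Ty.
  rewrite -addrA brDl; apply: memvD.
    by apply: (subvP (addvSl _ _)); rewrite brC memvN; apply: brQ'.
  rewrite {}ey -addrA brDr; apply: memvD.
    apply: (subvP (addvSl _ _)); apply: brQ' => //; vmem.
  apply: (subvP (addvSr _ _)); apply/vlineP; exists (a * b' - b * a').
  by rewrite !brE !brxx (brC c h); vect_ring.
exists Q', (Q' + <[br h c]>)%VS; split=> //.
- have sJ'T : (Q' + <[br h c]> <= T)%VS by apply: addline_sub => //; apply: aT.
  split; first exact: subv_trans sTT'.
  move=> x _ T'x /memv_addP[q Q'q [_ /vlineP[a ->] ->]].
  rewrite brDr brZr; apply: memvD.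
    by apply: (subvP (addvSl _ _)); apply: iQ'T'.2.
  (* Jacobi gives two brackets of elements of [T], since [T] is an ideal of [T']; [brT] puts both in
     [J']. *)
  by apply: memvZ; rewrite br_jacobi; apply: memvD; apply: brT => //; apply: iT.
- split; first exact: addvSl.
  by rewrite dim_addline //; apply: contra nMhc => /(subvP sQ'M).
split=> //; move/subvP/(_ _ (memv_addlineE _ _)) => Mhc.
by rewrite Mhc in nMhc.
Qed.

Lemma completion_line_factor M C : subalgebra br M -> in_S br M C ->
  (\dim C - \dim (strict_core br C))%N = 1%N ->
  \dim {:L} = (\dim M).+1 /\ exists Q J, line_factor M fullv Q J.
Proof.
move=> aM [cC [n [s [s0 sn sS]]] eMC] dC.
have [sKM sKC ltd] := strict_core_proper cC; have [aC nCM _] := cC.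
have iK := strict_core_ideal C.
set K := strict_core br C in sKM sKC ltd dC iK.
have dCK : \dim C = (\dim K).+1 by lia.
have [c nKc eC] := step_exists sKC dCK.
have dM : \dim {:L} = (\dim M).+1.
  rewrite -eMC eC addvA (addv_idPl sKM) dim_addline //.
  by apply: contra_notN nCM => Mc; rewrite eC addline_sub.
split=> //; rewrite -sn.
suff h i : (i <= n)%N -> exists Q J, line_factor M (s i) Q J by apply: h.
elim: i => [_|i IHi lt_in].
  (* The chain starts at [C] itself, with the factor [C / k(C)]. *)
  rewrite s0; exists K, C; split=> //.
  by split=> // x u _; apply: ideal_brr.
have [|Q [J fQJ]] := IHi; first exact: ltnW.
by apply: line_factor_lift fQJ => //; apply: sS.
Qed.

(** If [A :&: J] lies in [B], then [c] brackets [A] into [B], so [A :&: M] is an ideal and equals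
    [B], and [M] is a hyperplane. Otherwise [A = B + A :&: J] while [A :&: Q] lies in [B], so
    [A / B] is a quotient of [(A :&: J) / (A :&: Q)], of dimension at most one. *)
Lemma supplemented_chief_dim1 B A M Q J : chief_factor B A ->
  subalgebra br M -> \dim {:L} = (\dim M).+1 -> (B <= M)%VS -> ~ (A <= M)%VS ->
  line_factor M fullv Q J -> \dim A = (\dim B).+1.
Proof.
move=> chAB aM dM sBM nAM [iQ iJ [sQJ dJ] [sQM nJM]].
have [iB iA sBA neBA _] := chAB.
have [c Jc nMc] := not_subvP nJM; have [a0 Aa0 nMa0] := not_subvP nAM.
have [sAJB|/negP/not_subvP[u AJu nBu]] := boolP (A :&: J <= B)%VS.
  have eB : (A :&: M)%VS = B.
    apply: (chief_factor_proper chAB); last 1 first.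
    - by exists a0; rewrite // memv_cap negb_and nMa0 orbT.
    - apply/idealP => x u; rewrite !memv_cap => /andP[Au Mu].
      rewrite ideal_brr //=; have [a Ma] := hyperplaneP dM nMc x.
      rewrite -[x](subrK (a *: c)) brDl brZl; apply: memvD; first exact: aM.
      apply: memvZ; apply: (subvP sBM); apply: (subvP sAJB).
      by rewrite memv_cap ideal_brr //= ideal_brl.
    - by rewrite subv_cap sBA.
    - exact: capvSl.
  have := dimv_sum_cap A M; rewrite eB.
  have -> : (A + M)%VS = fullv.
    apply/eqP; rewrite eqEsubv subvf /=.
    rewrite (addline_step (subvf M) dM (memvf a0) nMa0).
    by rewrite addline_sub ?addvSr // (subvP (addvSl _ _)).
  by rewrite dM; lia.
have eA : (B + A :&: J)%VS = A.
  apply: (chief_factor_nonzero chAB).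
  - by apply: ideal_add => //; apply: ideal_cap.
  - exact: addvSl.
  - by rewrite subv_add sBA capvSl.
  - by exists u => //; apply: (subvP (addvSr _ _)).
have eB : (B + A :&: Q)%VS = B.
  apply: (chief_factor_proper chAB).
  - by apply: ideal_add => //; apply: ideal_cap.
  - exact: addvSl.
  - by rewrite subv_add sBA capvSl.
  - exists a0 => //; apply: contra nMa0; apply/subvP.
    by rewrite subv_add sBM (subv_trans (capvSr _ _)).
have ltBA := dim_proper sBA neBA.
have d1 := dimv_sum_cap B (A :&: J)%VS; rewrite eA in d1.
have d2 := dimv_sum_cap (A :&: J)%VS M.
have d3 := dimvS (subvf (A :&: J + M)%VS); rewrite dM in d3.
have : (\dim (A :&: J :&: M) <= \dim (B :&: (A :&: J)))%N.
  apply: dimvS; rewrite subv_cap capvSl andbT.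
  rewrite -capvA (hyperplane_cap sQJ dJ sQM nJM) -[X in (_ <= X)%VS]eB.
  exact: addvSr.
by lia.
Qed.

Lemma completions_ss_above :
  (forall M, maximal_subalgebra br M ->
     exists C, in_S br M C /\ (\dim C - \dim (strict_core br C))%N = 1%N) ->
  forall B, ideal br B -> ss_above B.
Proof.
move=> hS B; have [n] := ubnP (\dim {:L} - \dim B); elim: n B => // n IHn B leBn iB.
have [->|/eqP neB] := eqVneq B fullv; first by constructor.
have [|A [[iA sBA neAB] _ minA]] := @minimal_vspace F L
    (fun V => [/\ ideal br V, (B <= V)%VS & B <> V]) fullv.
  by split=> //; [apply: ideal_full | apply: subvf].
have chAB : chief_factor B A.
  split=> // I iI sBI sIA; have [->|/eqP neI] := eqVneq B I; first by left.
  by right; apply: minA.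
have ltBA := dim_proper sBA neAB; have leA := dimvS (subvf A).
have ssA : ss_above A by apply: IHn => //; lia.
apply: (ss_above_step iB iA sBA) => //.
have [frBA|nfr] := classic (frattini_over B A); first exact: frattini_chief_dim1.
have [U [aU sBU eUA neU]] : exists U,
    [/\ subalgebra br U, (B <= U)%VS, (U + A)%VS = fullv & U <> fullv].
  apply: NNPP => nU; apply: nfr => U aU sBU eUA; apply: NNPP => neU.
  by apply: nU; exists U.
(* Since [U + A] is all of [L], a proper subalgebra over [U] cannot contain [A]. *)
have [M [[aM neM] sUM maxM]] := @maximal_vspace F L
    (fun V => subalgebra br V /\ V <> fullv) U (conj aU neU).
have [|C [SC dC]] := hS M.
  split=> // K aK sMK; have [->|/eqP neK] := eqVneq K fullv; first by right.
  by left; apply: maxM.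
have [dM [Q [J fQJ]]] := completion_line_factor aM SC dC.
apply: (supplemented_chief_dim1 chAB aM dM _ _ fQJ).
  exact: subv_trans sUM.
by move=> sAM; apply: neM; apply/eqP; rewrite eqEsubv subvf -eUA subv_add sUM.
Qed.

End LieTheory.

Theorem theorem4p2 (F : fieldType) (L : vectType F) (br : L -> L -> L)
  (hL : lie_bracket br) :
  supersolvable br <->
  (forall M : {vspace L}, maximal_subalgebra br M ->
     exists C : {vspace L},
       in_S br M C /\ (\dim C - \dim (strict_core br C))%N = 1%N).
Proof.
split=> [/supersolvable_ss_above ss0 M|hS].
  exact: supersolvable_completion.
apply/supersolvable_ss_above; apply: completions_ss_above => //.
exact: ideal0.
Qed.
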